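(* Let $X$ be either the fidelity $F$ or the affinity $A$, and let $d_X(\rho,\sigma):=1-X^2(\rho,\sigma)$. Then $d_X$ satisfies strong contractibility: for any density matrices $\rho,\sigma$ on a finite-dimensional Hilbert space $\mathcal H$ and any family of operators $\{K_i\}$ on $\mathcal H$ with $\sum_i K_i^\dagger K_i=I$, setting $p_i=\mathrm{Tr}(K_i\rho K_i^\dagger)$, $q_i=\mathrm{Tr}(K_i\sigma K_i^\dagger)$ (assumed positive), $\rho_i=K_i\rho K_i^\dagger/p_i$ and $\sigma_i=K_i\sigma K_i^\dagger/q_i$, one has $$\sum_i p_i\, d_X(\rho_i,\sigma_i)\le d_X(\rho,\sigma).$$
   Context: For density matrices $\rho,\sigma$ on a finite-dimensional Hilbert space, the fidelity is $F(\rho,\sigma)=\|\sqrt\rho\sqrt\sigma\|_1=\mathrm{Tr}\sqrt{\sqrt\sigma\rho\sqrt\sigma}$ and the (quantum) affinity is $A(\rho,\sigma)=\mathrm{Tr}(\sqrt\rho\sqrt\sigma)$. The same formulas are used for unnormalized positive semidefinite operators. *)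

(* Defs.v *)
(* Finite-dimensional Hilbert space = C^n, C a numClosedFieldType
   (e.g. algC, complex numbers); operators = 'M[C]_n. *)
From HB Require Import structures.
From mathcomp Require Import all_boot all_order all_algebra.
Set Implicit Arguments. Unset Strict Implicit. Unset Printing Implicit Defensive.
Import Order.TTheory GRing.Theory Num.Theory Num.Def.
Local Open Scope ring_scope.

Section QDefs.
Variable C : numClosedFieldType.

Definition adjmx (m n : nat) (A : 'M[C]_(m, n)) : 'M[C]_(n, m) :=
  map_mx conjC A^T.

Definition psdmx (n : nat) (A : 'M[C]_n) : Prop :=
  A = adjmx A /\ forall v : 'rV[C]_n, 0 <= (v *m A *m adjmx v) 0 0.

Definition density (n : nat) (A : 'M[C]_n) : Prop :=
  psdmx A /\ \tr A = 1.

(* matrix square root by functional calculus on the spectral decomposition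
   A = P^-1 diag(d) P (P unitary, from mathcomp's spectral.v);
   for A PSD this is the unique PSD square root of A. *)
Definition msqrt (n : nat) (A : 'M[C]_n) : 'M[C]_n :=
  invmx (spectralmx A) *m diag_mx (map_mx sqrtC (spectral_diag A)) *m spectralmx A.

Definition fidelity (n : nat) (rho sigma : 'M[C]_n) : C :=
  \tr (msqrt (msqrt sigma *m rho *m msqrt sigma)).

Definition affinity (n : nat) (rho sigma : 'M[C]_n) : C :=
  \tr (msqrt rho *m msqrt sigma).

Definition dX (n : nat) (X : 'M[C]_n -> 'M[C]_n -> C) (rho sigma : 'M[C]_n) : C :=
  1 - (X rho sigma) ^+ 2.

End QDefs.

(* Main.v *)
(* Write A_i = K_i rho K_i^H and B_i = K_i sigma K_i^H. Since X is homogeneous of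
   degree 1/2 in each argument, the left-hand side is 1 - sum_i X(A_i, B_i)^2 / q_i,
   at most 1 - (sum_i X(A_i, B_i))^2 by Cauchy-Schwarz, so it is enough that
   X(rho, sigma) <= sum_i X(A_i, B_i).
   For the fidelity, F(rho, sigma) is the maximum of Re tr (V W^H) over the
   factorizations rho = V V^H, sigma = W W^H, and K_i V, K_i W factor A_i, B_i.
   For the affinity, left multiplication by rho and right multiplication by sigma
   commute, and U |-> sqrt rho U sqrt sigma is their geometric mean, the largest
   Hermitian off-diagonal block of a positive block operator with them on the
   diagonal. Pulling rho, sigma back along (U_i) |-> sum_i K_i^H U_i K_i gives, by
   the Kadison-Schwarz inequality, such a block for the operators of A_i, B_i;
   maximality evaluated at (1, ..., 1) is the claim. *)
Require Import Defs.
From HB Require Import structures.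
From mathcomp Require Import all_boot all_order all_algebra.
From mathcomp Require Import ring.
Set Implicit Arguments. Unset Strict Implicit. Unset Printing Implicit Defensive.
Import Order.TTheory GRing.Theory Num.Theory.
Local Open Scope ring_scope.

Local Notation "A ^H" := (adjmx A) (at level 8, format "A ^H").

(** * Adjoints and the Hilbert-Schmidt inner product [tr (A B^H)] *)

Section Adjoint.
Variable C : numClosedFieldType.

Lemma adjmxE m n (A : 'M[C]_(m, n)) i j : A^H i j = (A j i)^*.
Proof. by rewrite !mxE. Qed.

Lemma adjmxK m n : cancel (@adjmx C m n) (@adjmx C n m).
Proof. by move=> A; apply/matrixP => i j; rewrite !adjmxE conjCK. Qed.

Lemma adjmxM m n p (A : 'M[C]_(m, n)) (B : 'M_(n, p)) :
  (A *m B)^H = B^H *m A^H.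
Proof. by rewrite /adjmx trmx_mul map_mxM. Qed.

Lemma adjmxD m n (A B : 'M[C]_(m, n)) : (A + B)^H = A^H + B^H.
Proof. by rewrite /adjmx linearD map_mxD. Qed.

Lemma adjmxN m n (A : 'M[C]_(m, n)) : (- A)^H = - A^H.
Proof. by rewrite /adjmx linearN map_mxN. Qed.

Lemma adjmxB m n (A B : 'M[C]_(m, n)) : (A - B)^H = A^H - B^H.
Proof. by rewrite adjmxD adjmxN. Qed.

Lemma adjmxZ m n c (A : 'M[C]_(m, n)) : (c *: A)^H = c^* *: A^H.
Proof. by rewrite /adjmx linearZ map_mxZ. Qed.

Lemma adjmx1 n : (1%:M : 'M[C]_n)^H = 1%:M.
Proof. by rewrite /adjmx trmx1 map_mx1. Qed.

Lemma adjmx0 m n : (0 : 'M[C]_(m, n))^H = 0.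
Proof. by rewrite /adjmx trmx0 map_mx0. Qed.

Lemma adjmx_sum m n I (r : seq I) (P : pred I) (F : I -> 'M[C]_(m, n)) :
  (\sum_(i <- r | P i) F i)^H = \sum_(i <- r | P i) (F i)^H.
Proof. by apply: (big_morph _ (@adjmxD m n) (adjmx0 m n)). Qed.

Lemma adjmx_diag n (d : 'rV[C]_n) : (diag_mx d)^H = diag_mx (map_mx Num.conj d).
Proof. by rewrite /adjmx tr_diag_mx map_diag_mx. Qed.

Lemma mxtrace_adj n (A : 'M[C]_n) : \tr A^H = (\tr A)^*.
Proof. by rewrite rmorph_sum; apply: eq_bigr => i _; rewrite adjmxE. Qed.

Lemma trmul_adjE m n (A B : 'M[C]_(m, n)) :
  \tr (A *m B^H) = \sum_i \sum_j A i j * (B i j)^*.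
Proof.
by apply: eq_bigr => i _; rewrite mxE; apply: eq_bigr => j _; rewrite adjmxE.
Qed.

Lemma trmul_adj_ge0 m n (A : 'M[C]_(m, n)) : 0 <= \tr (A *m A^H).
Proof.
rewrite trmul_adjE; apply: sumr_ge0 => i _; apply: sumr_ge0 => j _.
by rewrite mul_conjC_ge0.
Qed.

Lemma trmul_adj_eq0 m n (A : 'M[C]_(m, n)) : \tr (A *m A^H) <= 0 -> A = 0.
Proof.
move=> A_le0; have /eqP : \tr (A *m A^H) = 0.
  by apply: le_anti; rewrite A_le0 trmul_adj_ge0.
rewrite trmul_adjE psumr_eq0 => [/allP Aeq0|i _]; last first.
  by apply: sumr_ge0 => j _; rewrite mul_conjC_ge0.
apply/matrixP => i j; have := Aeq0 i (mem_index_enum _).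
rewrite /= psumr_eq0 => [/allP/(_ j (mem_index_enum _))|k _].
  by rewrite /= mul_conjC_eq0 mxE => /eqP.
by rewrite mul_conjC_ge0.
Qed.

Lemma trmul_adjC m n (A B : 'M[C]_(m, n)) : \tr (B *m A^H) = (\tr (A *m B^H))^*.
Proof. by rewrite -mxtrace_adj adjmxM adjmxK. Qed.

(** Expand [tr ((A - B) (A - B)^H) >= 0]. For matrices this replaces Cauchy-Schwarz below: it
    involves no square roots of norms, and [z + z^*] stands for twice a real part. *)
Lemma trmul_adj_amgm m n (A B : 'M[C]_(m, n)) :
  \tr (A *m B^H) + \tr (B *m A^H) <= \tr (A *m A^H) + \tr (B *m B^H).
Proof.
have := trmul_adj_ge0 (A - B).
rewrite adjmxB mulmxBl !mulmxBr !mxtraceD !(raddfN (@mxtrace C m)).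
by move=> AB_ge0; rewrite -subr_ge0; congr (0 <= _): AB_ge0; ring.
Qed.

Lemma mx11_tr (A : 'M[C]_1) : A 0 0 = \tr A.
Proof. by rewrite /mxtrace big_ord1. Qed.

End Adjoint.

(** * Functional calculus on the spectral decomposition *)

Section FunctionalCalculus.
Variables (C : numClosedFieldType) (n : nat).
Implicit Types (A B : 'M[C]_n) (f g : C -> C).

(* [msqrt A] is [fcal sqrtC A], by conversion. *)
Definition fcal f A : 'M[C]_n :=
  invmx (spectralmx A) *m diag_mx (map_mx f (spectral_diag A)) *m spectralmx A.

Lemma spectralmxV A : invmx (spectralmx A) = (spectralmx A)^H.
Proof. exact/invmx_unitary/spectral_unitarymx. Qed.

Lemma spectralmxK A : spectralmx A *m (spectralmx A)^H = 1%:M.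
Proof. exact/unitarymxP/spectral_unitarymx. Qed.

Lemma spectralmxVK A : (spectralmx A)^H *m spectralmx A = 1%:M.
Proof. by rewrite -spectralmxV mulVmx// spectral_unit. Qed.

Lemma fcalM A f g : fcal f A *m fcal g A = fcal (fun x => f x * g x) A.
Proof.
rewrite /fcal !mulmxA mulmxK ?spectral_unit// -!mulmxA; congr (_ *m _).
rewrite !mulmxA mulmx_diag; congr (diag_mx _ *m _).
by apply/rowP => i; rewrite !mxE.
Qed.

Lemma eq_fcal A f g : (forall i, f (spectral_diag A 0 i) = g (spectral_diag A 0 i)) ->
  fcal f A = fcal g A.
Proof.
move=> fg; congr (_ *m diag_mx _ *m _).
by apply/rowP => i; rewrite !mxE fg.
Qed.

Lemma fcal_adj A f : (fcal f A)^H = fcal (fun x => (f x)^*) A.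
Proof.
rewrite /fcal spectralmxV !adjmxM adjmxK adjmx_diag mulmxA.
by congr (_ *m diag_mx _ *m _); apply/rowP => i; rewrite !mxE.
Qed.

Lemma fcal_id A : A = A^H -> fcal id A = A.
Proof.
move=> hA; rewrite /fcal map_mx_id//.
by apply/esym/orthomx_spectralP/normalmxP; rewrite -[map_mx _ _]/(A^H) -hA.
Qed.

Lemma spectral_diag_real A i : A = A^H -> spectral_diag A 0 i \is Num.real.
Proof.
move=> hA; have /mxOverP -> // : spectral_diag A \is a mxOver Num.real.
apply: hermitian_spectral_diag_real; apply/is_hermitianmxP.
by rewrite expr0 scale1r.
Qed.

Lemma spectral_row A i : A = A^H ->
  row i (spectralmx A) *m A = spectral_diag A 0 i *: row i (spectralmx A).
Proof.
move=> hA; rewrite -{2}(fcal_id hA) /fcal spectralmxV map_mx_id//.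
rewrite -row_mul !mulmxA spectralmxK mul1mx.
by apply/rowP => j; rewrite mul_diag_mx !mxE.
Qed.

Lemma spectral_row_norm A i :
  \tr (row i (spectralmx A) *m (row i (spectralmx A))^H) = 1.
Proof.
rewrite -mx11_tr.
have := congr1 (fun M : 'M_n => M i i) (spectralmxK A).
rewrite [1%:M i i]mxE eqxx mulr1n => <-; rewrite !mxE.
by apply: eq_bigr => j _; rewrite !mxE.
Qed.

End FunctionalCalculus.

(** * Positive semidefinite matrices, their square roots, and the polar decomposition *)

Section Psd.
Variable C : numClosedFieldType.

Lemma psd_mul_adj n k (A : 'M[C]_(n, k)) : psdmx (A *m A^H).
Proof.
split=> [|v]; first by rewrite adjmxM adjmxK.
by rewrite mx11_tr mulmxA -mulmxA -adjmxM trmul_adj_ge0.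
Qed.

Lemma psd_spectral_ge0 n (A : 'M[C]_n) i : psdmx A -> 0 <= spectral_diag A 0 i.
Proof.
case=> hA /(_ (row i (spectralmx A))).
by rewrite mx11_tr spectral_row// -scalemxAl mxtraceZ spectral_row_norm mulr1.
Qed.

Lemma msqrt_adj n (A : 'M[C]_n) : psdmx A -> (msqrt A)^H = msqrt A.
Proof.
move=> pA; rewrite -[msqrt A]/(fcal sqrtC A) fcal_adj; apply: eq_fcal => i.
by rewrite geC0_conj// sqrtC_ge0 psd_spectral_ge0.
Qed.

Lemma msqrtK n (A : 'M[C]_n) : psdmx A -> msqrt A *m msqrt A = A.
Proof.
move=> pA; rewrite -[msqrt A]/(fcal sqrtC A) fcalM.
rewrite -[RHS]fcal_id; last by case: pA.
by apply: eq_fcal => i; rewrite -expr2 sqrtCK.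
Qed.

Lemma msqrt_psd n (A : 'M[C]_n) : psdmx A -> psdmx (msqrt A).
Proof.
move=> pA; pose B := fcal (sqrtC \o sqrtC) A.
suff -> : msqrt A = B *m B^H by exact: psd_mul_adj.
rewrite fcal_adj fcalM; apply: eq_fcal => i /=.
by rewrite geC0_conj -?expr2 ?sqrtCK// !sqrtC_ge0 psd_spectral_ge0.
Qed.

Lemma psd_congr n k (A : 'M[C]_n) (X : 'M_(k, n)) :
  psdmx A -> psdmx (X *m A *m X^H).
Proof.
move=> pA; rewrite -{1}(msqrtK pA) -{2}(msqrt_adj pA) mulmxA -mulmxA -adjmxM.
exact: psd_mul_adj.
Qed.

Lemma psd_tr_ge0 n (A : 'M[C]_n) : psdmx A -> 0 <= \tr A.
Proof.
by move=> pA; rewrite -(msqrtK pA) -{2}(msqrt_adj pA) trmul_adj_ge0.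
Qed.

Lemma psdZ n (A : 'M[C]_n) c : 0 <= c -> psdmx A -> psdmx (c *: A).
Proof.
move=> c_ge0 [hA pA]; split=> [|v]; first by rewrite adjmxZ -hA geC0_conj.
by rewrite -scalemxAr -scalemxAl mxE mulr_ge0.
Qed.

(** Otherwise some row of [spectralmx A] would be a unit eigenvector for a negative eigenvalue. In
    this form, positivity is proved by refuting one hypothetical eigenvector. *)
Lemma herm_psd n (A : 'M[C]_n) : A = A^H ->
  (forall (w : 'rV_n) a, a < 0 -> w *m A = a *: w -> w = 0) -> psdmx A.
Proof.
move=> hA noneg.
suff d_ge0 i : 0 <= spectral_diag A 0 i.
  pose B := fcal sqrtC A; suff -> : A = B *m B^H by exact: psd_mul_adj.
  rewrite fcal_adj fcalM -[LHS]fcal_id//; apply: eq_fcal => i.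
  by rewrite geC0_conj -?expr2 ?sqrtCK ?sqrtC_ge0.
rewrite real_leNgt ?spectral_diag_real ?real0//; apply/negP => d_lt0.
have w0 := noneg _ _ d_lt0 (spectral_row i hA).
have := spectral_row_norm A i; rewrite w0 mul0mx mxtrace0 => /eqP.
by rewrite eq_sym oner_eq0.
Qed.

Lemma herm_eq0 n (A : 'M[C]_n) : A = A^H ->
  (forall (w : 'rV_n) a, a \is Num.real -> a != 0 -> w *m A = a *: w -> w = 0) -> A = 0.
Proof.
move=> hA nonz; rewrite -(fcal_id hA).
suff d0 i : spectral_diag A 0 i = 0.
  rewrite (@eq_fcal _ _ A _ (fun=> 0)) => [|//].
  rewrite /fcal (_ : map_mx _ _ = 0) ?linear0 ?mulmx0 ?mul0mx//.
  by apply/rowP => i; rewrite !mxE.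
apply/eqP/negP => /negP d_neq0.
have w0 := nonz _ _ (spectral_diag_real i hA) d_neq0 (spectral_row i hA).
have := spectral_row_norm A i; rewrite w0 mul0mx mxtrace0 => /eqP.
by rewrite eq_sym oner_eq0.
Qed.

(** Let [w] be an eigenvector of [R - S] for a real [a != 0]. Since
    [R^2 - S^2 = R (R - S) + (R - S) S], the sum of [w R w^H] and [w S w^H] is 0; both are
    nonnegative, so both vanish, and [a w w^H], their difference, is 0. *)
Lemma psd_sqr_inj n (R S : 'M[C]_n) : psdmx R -> psdmx S ->
  R *m R = S *m S -> R = S.
Proof.
move=> [hR pR] [hS pS] eqRS; apply/eqP; rewrite -subr_eq0; apply/eqP.
have hD : R - S = (R - S)^H by rewrite adjmxB -hR -hS.
apply: herm_eq0 => // w a a_real a_neq0 wD.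
have Dw : (R - S) *m w^H = a *: w^H by rewrite hD -adjmxM wD adjmxZ conj_Creal.
have : w *m (R *m R - S *m S) *m w^H = 0 by rewrite eqRS subrr mulmx0 mul0mx.
have -> : R *m R - S *m S = R *m (R - S) + (R - S) *m S.
  by rewrite mulmxBr mulmxBl addrA subrK.
rewrite mulmxDr mulmxDl !mulmxA wD -[_ *m (R - S) *m _]mulmxA Dw.
rewrite -scalemxAr -!scalemxAl -scalerDr => /eqP.
rewrite scaler_eq0 (negPf a_neq0) => /eqP/matrixP/(_ 0 0).
rewrite mxE [RHS]mxE => /eqP; rewrite paddr_eq0// => /andP[/eqP wR /eqP wS].
apply: trmul_adj_eq0; rewrite -(mulKf a_neq0 (\tr _)) -mxtraceZ scalemxAl -wD.
by rewrite mulmxBr mulmxBl raddfB /= -!mx11_tr wR wS subrr mulr0.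
Qed.

Lemma msqrt_uniq n (A R : 'M[C]_n) : psdmx R -> R *m R = A -> msqrt A = R.
Proof.
move=> pR RR; have pA : psdmx A by rewrite -RR {2}(proj1 pR); exact: psd_mul_adj.
by apply: psd_sqr_inj => //; [exact: msqrt_psd | rewrite msqrtK].
Qed.

Lemma msqrtZ n (A : 'M[C]_n) c : 0 <= c -> psdmx A ->
  msqrt (c *: A) = sqrtC c *: msqrt A.
Proof.
move=> c_ge0 pA; apply: msqrt_uniq.
  by apply: psdZ (msqrt_psd pA); rewrite sqrtC_ge0.
by rewrite -scalemxAl -scalemxAr scalerA -expr2 sqrtCK msqrtK.
Qed.

Lemma mul_adj_eq0 n k (A : 'M[C]_(n, k)) : A *m A^H = 0 -> A = 0.
Proof. by move=> AA; apply: trmul_adj_eq0; rewrite AA mxtrace0. Qed.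

(* The partial isometry of the polar decomposition, obtained by applying to [V]
   the pseudo-inverse of [msqrt (V *m V^H)] (recall that [0^-1 = 0]). *)
Lemma polar n k (V : 'M[C]_(n, k)) (S := msqrt (V *m V^H)) :
  exists R : 'M_(n, k),
    [/\ V = S *m R, S = V *m R^H & R *m R^H *m R = R].
Proof.
set A := V *m V^H; have pA : psdmx A by exact: psd_mul_adj.
have hA : A = A^H by case: pA.
pose G := fcal (fun x => (sqrtC x)^-1) A.
(* [E] is the projection onto the range of [A]. *)
pose E := fcal (fun x => (x != 0)%:R) A.
have hG : G^H = G.
  rewrite fcal_adj; apply: eq_fcal => i.
  by rewrite geC0_conj// invr_ge0 sqrtC_ge0 psd_spectral_ge0.
have hE : (1%:M - E)^H = 1%:M - E.
  rewrite adjmxB adjmx1 fcal_adj; congr (_ - _).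
  by apply: eq_fcal => i; rewrite conjC_nat.
have SG : S *m G = E.
  rewrite fcalM; apply: eq_fcal => i; have [->|d_neq0] := eqVneq (spectral_diag A 0 i) 0.
    by rewrite sqrtC0 mul0r.
  by rewrite divff// sqrtC_eq0.
have EG : E *m G = G.
  rewrite fcalM; apply: eq_fcal => i; have [->|d_neq0] := eqVneq (spectral_diag A 0 i) 0.
    by rewrite sqrtC0 invr0 mulr0.
  by rewrite mul1r.
have GE : G *m E = G.
  by rewrite -[RHS]EG !fcalM; apply: eq_fcal => i; rewrite mulrC.
have AG : A *m G = S.
  rewrite -{1}(msqrtK pA) -mulmxA SG fcalM; apply: eq_fcal => i.
  by have [->|] := eqVneq (spectral_diag A 0 i) 0; rewrite ?sqrtC0 ?mul0r// mulr1.
(* [1 - E] kills [A = V V^H], hence the Gram matrix of [(1 - E) V], hence [(1 - E) V] itself. *)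
have EV : E *m V = V.
  apply/eqP; rewrite eq_sym -subr_eq0; apply/eqP/mul_adj_eq0.
  rewrite -{1 3}[V]mul1mx -mulmxBl adjmxM hE mulmxA -(mulmxA _ V) -/A.
  rewrite mulmxBl mul1mx (_ : E *m A = A) ?subrr ?mul0mx//.
  rewrite -{1}(fcal_id hA) fcalM -[RHS]fcal_id//; apply: eq_fcal => i.
  by have [->|] := eqVneq (spectral_diag A 0 i) 0; rewrite ?mulr0 ?mul1r.
clearbody G E; exists (G *m V); split.
- by rewrite mulmxA SG EV.
- by rewrite adjmxM hG mulmxA -/A AG.
by rewrite adjmxM hG !mulmxA -(mulmxA G V) -/A -(mulmxA G A) AG -(mulmxA G S) SG GE.
Qed.

Lemma pisom_adj n k (R : 'M[C]_(n, k)) :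
  R *m R^H *m R = R -> R^H *m R^H^H *m R^H = R^H.
Proof. by move=> hR; rewrite -!adjmxM mulmxA hR. Qed.

(** For a partial isometry, [1 - R R^H] is a projection, and the two sides differ by the squared
    norm of [X (1 - R R^H)]. Chaining this bound handles products of partial isometries. *)
Lemma pisom_contract n k (R : 'M[C]_(n, k)) : R *m R^H *m R = R ->
  forall l (X : 'M_(l, n)), \tr (X *m R *m (X *m R)^H) <= \tr (X *m X^H).
Proof.
move=> hR l X; rewrite -subr_ge0.
have hE : (1%:M - R *m R^H)^H = 1%:M - R *m R^H.
  by rewrite adjmxB adjmx1 adjmxM adjmxK.
suff -> : \tr (X *m X^H) - \tr (X *m R *m (X *m R)^H)
    = \tr (X *m (1%:M - R *m R^H) *m (X *m (1%:M - R *m R^H))^H).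
  exact: trmul_adj_ge0.
rewrite (adjmxM X (1%:M - _)) hE !mulmxA -(mulmxA X (1%:M - _)).
rewrite mulmxBr mulmx1 mulmxBl mul1mx !mulmxA hR subrr subr0.
by rewrite mulmxBr mulmx1 mulmxBl raddfB /= adjmxM !mulmxA.
Qed.

End Psd.

Section Fidelity.
Variable C : numClosedFieldType.

(** With [B] the square root of [P], [tr (Q P)] is the inner product of [B Q] and [B], and the
    contraction [Q] does not increase the norm of [B]. *)
Lemma trmul_contract_le n (P Q : 'M[C]_n) : psdmx P ->
  (forall l (X : 'M_(l, n)), \tr (X *m Q *m (X *m Q)^H) <= \tr (X *m X^H)) ->
  \tr (Q *m P) + (\tr (Q *m P))^* <= \tr P + \tr P.
Proof.
move=> pP Qle; pose B := msqrt P.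
have BB : B *m B^H = P by rewrite msqrt_adj// msqrtK.
have -> : \tr (Q *m P) = \tr (B *m Q *m B^H).
  by rewrite -BB mulmxA mxtrace_mulC mulmxA msqrt_adj.
rewrite -(trmul_adjC (B *m Q) B); apply: le_trans (trmul_adj_amgm _ _) _.
by rewrite BB lerD2r; apply: le_trans (Qle _ _) _; rewrite BB.
Qed.

Lemma fidelityE n (rho sigma : 'M[C]_n) (M := msqrt sigma *m msqrt rho) :
  psdmx rho -> psdmx sigma -> fidelity rho sigma = \tr (msqrt (M *m M^H)).
Proof.
move=> pr ps; rewrite /fidelity; congr (\tr (msqrt _)).
by rewrite /M adjmxM !msqrt_adj// mulmxA -(mulmxA _ (msqrt rho) (msqrt rho)) msqrtK.
Qed.

Lemma fidelity_ge0 n (rho sigma : 'M[C]_n) :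
  psdmx rho -> psdmx sigma -> 0 <= fidelity rho sigma.
Proof.
by move=> pr ps; rewrite fidelityE//; apply/psd_tr_ge0/msqrt_psd/psd_mul_adj.
Qed.

(** Polar decompositions [V = r R], [W = s S] and [s r = P U] give [tr (V W^H) = tr (U R S^H P)],
    where [U R S^H] is a contraction and [tr P] is the fidelity. *)
Lemma fidelity_ub n k (V W : 'M[C]_(n, k)) :
  \tr (V *m W^H) + (\tr (V *m W^H))^*
    <= fidelity (V *m V^H) (W *m W^H) + fidelity (V *m V^H) (W *m W^H).
Proof.
rewrite fidelityE; try exact: psd_mul_adj.
have [R [VE _ hR]] := polar V; have [S [WE _ hS]] := polar W.
set r := msqrt (V *m V^H) in VE *; set s := msqrt (W *m W^H) in WE *.
have hs : s^H = s by rewrite msqrt_adj//; exact: psd_mul_adj.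
have [U [ME _ hU]] := polar (s *m r).
set P := msqrt _ in ME *.
have pP : psdmx P by exact/msqrt_psd/psd_mul_adj.
clearbody P r s.
have -> : \tr (V *m W^H) = \tr (U *m R *m S^H *m P).
  rewrite VE WE adjmxM hs mulmxA mxtrace_mulC !mulmxA ME.
  by rewrite -!mulmxA mxtrace_mulC !mulmxA.
apply: trmul_contract_le => [//|l X].
rewrite !mulmxA.
apply: le_trans (pisom_contract (pisom_adj hS) _) _.
apply: le_trans (pisom_contract hR _) _.
exact: pisom_contract.
Qed.

(** The polar decomposition of [s r] writes the fidelity as [tr (s r R^H)], so [r R^H] and [s] would
    do if [R] were unitary. As [R] is only a partial isometry, [n] more columns restore the part of
    [rho] lost on the complement of [E = R^H R]; they meet zero columns of [W] and leave the trace
    unchanged. *)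
Lemma fidelity_attained n (rho sigma : 'M[C]_n) : psdmx rho -> psdmx sigma ->
  exists V W : 'M_(n, n + n),
    [/\ rho = V *m V^H, sigma = W *m W^H & fidelity rho sigma = \tr (V *m W^H)].
Proof.
move=> pr ps; rewrite fidelityE//.
set r := msqrt rho; set s := msqrt sigma.
have [hr rr] : r^H = r /\ r *m r = rho by rewrite msqrt_adj// msqrtK.
have [hs ss] : s^H = s /\ s *m s = sigma by rewrite msqrt_adj// msqrtK.
have [R [_ PE hR]] := polar (s *m r).
clearbody r s; rewrite PE.
have [E ER] : exists E, E = R^H *m R by exists (R^H *m R).
have hE : E^H = E by rewrite ER adjmxM adjmxK.
have EE : E *m E = E by rewrite ER mulmxA -(mulmxA R^H) -(mulmxA R^H) hR.
exists (row_mx (r *m R^H) (r *m (1%:M - E))), (row_mx s 0).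
have adj_row (A B : 'M[C]_n) : (row_mx A B)^H = col_mx A^H B^H.
  by rewrite /adjmx tr_row_mx map_col_mx.
rewrite !adj_row !mul_row_col adjmx0 mul0mx mulmx0 !addr0.
rewrite !adjmxM adjmxK hs hr adjmxB adjmx1 hE; split=> //.
  rewrite !mulmxA -(mulmxA r R^H) -ER -(mulmxA r (1%:M - E)).
  have -> : (1%:M - E) *m (1%:M - E) = 1%:M - E.
    by rewrite mulmxBl mul1mx mulmxBr mulmx1 EE subrr subr0.
  by rewrite -mulmxDl -mulmxDr addrC subrK mulmx1.
by rewrite -mulmxA mxtrace_mulC.
Qed.

Lemma fidelity_mono n m (rho sigma : 'M[C]_n) (K : 'I_m -> 'M_n) :
  psdmx rho -> psdmx sigma -> \sum_i (K i)^H *m K i = 1%:M ->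
  fidelity rho sigma <=
    \sum_i fidelity (K i *m rho *m (K i)^H) (K i *m sigma *m (K i)^H).
Proof.
move=> pr ps K1.
have [V [W [rV sW FE]]] := fidelity_attained pr ps.
have FS : fidelity rho sigma = \sum_i \tr (K i *m V *m (K i *m W)^H).
  rewrite FE -[V in LHS]mul1mx -K1 !mulmx_suml raddf_sum /=.
  apply: eq_bigr => i _.
  by rewrite adjmxM -!mulmxA mxtrace_mulC !mulmxA.
(* [fidelity_ub] controls twice a real part, so the goal is doubled and one copy of the real number
   [fidelity rho sigma] is replaced by its conjugate. *)
rewrite -(@ler_pMn2r _ 2)// !mulr2n.
rewrite -{2}(geC0_conj (fidelity_ge0 pr ps)) FS rmorph_sum -!big_split /=.
apply: ler_sum => i _; apply: le_trans (fidelity_ub _ _) _.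
by rewrite !adjmxM rV sW !mulmxA.
Qed.

End Fidelity.

(** * Maximality of the geometric mean of commuting positive operators *)

Section GeometricMean.
Variables (C : numClosedFieldType) (n : nat).

Definition diagf (f : 'I_n -> C) : 'M_n := diag_mx (\row_i f i).

Lemma diagfM f g : diagf f *m diagf g = diagf (fun i => f i * g i).
Proof.
by rewrite /diagf mulmx_diag; congr diag_mx; apply/rowP => i; rewrite !mxE.
Qed.

Lemma eq_diagf f g : f =1 g -> diagf f = diagf g.
Proof. by move=> fg; congr diag_mx; apply/rowP => i; rewrite !mxE fg. Qed.

Lemma diagf_adj f : (forall i, 0 <= f i) -> (diagf f)^H = diagf f.
Proof.
move=> f_ge0; rewrite /diagf adjmx_diag; congr diag_mx.
by apply/rowP => i; rewrite !mxE geC0_conj.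
Qed.

Lemma diagf_psd f : (forall i, 0 <= f i) -> psdmx (diagf f).
Proof.
move=> f_ge0; have -> : diagf f = diagf (sqrtC \o f) *m (diagf (sqrtC \o f))^H.
  rewrite diagf_adj => [|i]; last by rewrite sqrtC_ge0.
  by rewrite diagfM; apply: eq_diagf => i; rewrite /= -expr2 sqrtCK.
exact: psd_mul_adj.
Qed.

Lemma trmul_diagf (u : 'rV[C]_n) f :
  \tr (u *m diagf f *m u^H) = \sum_i f i * (u 0 i * (u 0 i)^*).
Proof.
rewrite -mx11_tr mxE; apply: eq_bigr => i _.
by rewrite mul_mx_diag adjmxE !mxE mulrAC mulrC.
Qed.

(* The geometric mean of two commuting positive operators is the largest
   Hermitian off-diagonal block completing them to a positive block operator;
   here the operators are diagonal and the block operator is a Gram matrix. *)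
Lemma geomean_max d (a b : 'I_n -> C) (M L : 'M[C]_(n, d)) :
  (forall i, 0 <= a i) -> (forall i, 0 <= b i) ->
  (forall u : 'rV_n, \tr (u *m M *m (u *m M)^H) <= \tr (u *m diagf a *m u^H)) ->
  (forall u : 'rV_n, \tr (u *m L *m (u *m L)^H) <= \tr (u *m diagf b *m u^H)) ->
  M *m L^H = L *m M^H ->
  psdmx (diagf (fun i => sqrtC (a i) * sqrtC (b i)) - M *m L^H).
Proof.
move=> a_ge0 b_ge0 aM bL ML.
(* Since [0^-1 = 0], [g] is a pseudo-inverse of the root of [a]. Below, [s] is the root of [b / a]
   where [a] is nonzero and 0 elsewhere, and [q] is the indicator of the kernel of [a]. *)
pose g i := (sqrtC (a i))^-1.
have sa_ge0 i : 0 <= sqrtC (a i) by rewrite sqrtC_ge0.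
have sb_ge0 i : 0 <= sqrtC (b i) by rewrite sqrtC_ge0.
have g_ge0 i : 0 <= g i by rewrite invr_ge0.
pose s i := sqrtC (b i) * g i.
have s_ge0 i : 0 <= s i by rewrite mulr_ge0.
pose q i : C := (a i == 0)%:R.
have q_ge0 i : 0 <= q i by rewrite ler0n.
have gq i : g i * a i * g i = 1 - q i.
  rewrite /g /q; have [->|a0] := eqVneq; first by rewrite mulr0 mul0r subrr.
  rewrite -{2}(sqrtCK (a i)) expr2 !mulrA mulVf ?sqrtC_eq0// mul1r.
  by rewrite divff ?subr0// sqrtC_eq0.
have sag i : sqrtC (a i) * g i = 1 - q i.
  rewrite /g /q; have [->|a0] := eqVneq; first by rewrite sqrtC0 mul0r subrr.
  by rewrite divff ?subr0// sqrtC_eq0.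
have p_ge0 i : 0 <= 1 - q i by rewrite -sag mulr_ge0.
have diagqB : diagf (fun i => 1 - q i) = 1%:M - diagf q.
  by apply/matrixP => i j; rewrite !mxE -mulrnBl.
(* Where [a] vanishes, [aM] bounds the norm of the row of [M] by 0. *)
have qM : diagf q *m M = 0.
  apply/row_matrixP => i; rewrite row0 rowE mulmxA; apply: trmul_adj_eq0.
  apply: le_trans (aM _) _; rewrite -(mulmxA _ (diagf q)) diagfM.
  rewrite (_ : diagf _ = 0) ?mulmx0 ?mul0mx ?mxtrace0//.
  apply/matrixP => j k; rewrite !mxE /q; case: eqVneq => [->|_].
    by rewrite mulr0 mul0rn.
  by rewrite mul0r mul0rn.
have pM : diagf (fun i => 1 - q i) *m M = M.
  by rewrite diagqB mulmxBl qM mul1mx subr0.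
pose A := diagf (sqrtC \o a); pose G := diagf g; pose S := diagf s.
have hA : A^H = A by exact: diagf_adj.
have hG : G^H = G by exact: diagf_adj.
have hS : S^H = S by exact: diagf_adj.
have AG : A *m G = diagf (fun i => 1 - q i) by rewrite diagfM; apply: eq_diagf.
have GaG : G *m diagf a *m G = diagf (fun i => 1 - q i).
  by rewrite !diagfM; apply: eq_diagf.
have GbG : G *m diagf b *m G = S *m S.
  rewrite !diagfM; apply: eq_diagf => i.
  by rewrite /s -{1}(sqrtCK (b i)); ring.
have ASA : A *m S *m A = diagf (fun i => sqrtC (a i) * sqrtC (b i)).
  rewrite !diagfM; apply: eq_diagf => i.
  rewrite /s /= -[LHS]mulrA -[X in _ * X]mulrA [g i * _]mulrC sag.
  by rewrite /q; case: eqVneq => [->|]; rewrite ?sqrtC0 ?mul0r// subr0 mulr1.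
have pS : psdmx S by exact: diagf_psd.
have qq : diagf q *m (diagf q)^H = diagf q.
  rewrite diagf_adj// diagfM; apply: eq_diagf => i.
  by rewrite /q -natrM mulnb andbb.
clearbody A G S.
(* Conjugation by [G] turns [a] into the projection [1 - q] and [b] into [S^2]. If [w] is an
   eigenvector for [e < 0], then [u = w S - e w] equals [w G M L^H G], and the two bounds on [M] and
   [L] give [|u| <= |w S|]. *)
have pH : psdmx (S - G *m (M *m L^H) *m G).
  apply: herm_psd => [|w e e_lt0 wH].
    by rewrite adjmxB !adjmxM hS hG adjmxK -ML !mulmxA.
  pose u := w *m S - e *: w.
  have uE : u = w *m G *m L *m M^H *m G.
    by rewrite /u -wH mulmxBr opprB addrCA subrr addr0 ML !mulmxA.
  have uu : u *m u^H = (w *m G *m L) *m (u *m G *m M)^H.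
    by rewrite {1}uE !adjmxM hG !mulmxA.
  have := trmul_adj_amgm (w *m G *m L) (u *m G *m M).
  rewrite (trmul_adjC (w *m G *m L)) -uu geC0_conj ?trmul_adj_ge0// => uu_le.
  have L_le : \tr (w *m G *m L *m (w *m G *m L)^H) <= \tr (w *m S *m (w *m S)^H).
    by apply: le_trans (bL _) _; rewrite !adjmxM hG hS !mulmxA -!(mulmxA w) GbG.
  have M_le : \tr (u *m G *m M *m (u *m G *m M)^H) <= \tr (u *m u^H).
    apply: le_trans (aM _) _; rewrite !adjmxM hG !mulmxA -!(mulmxA u) GaG diagqB.
    rewrite mulmxA mulmxBr mulmx1 mulmxBl raddfB /= gerBl -qq.
    by rewrite mulmxA -mulmxA -adjmxM trmul_adj_ge0.
  have : \tr (u *m u^H) <= \tr (w *m S *m (w *m S)^H).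
    by rewrite -(lerD2r (\tr (u *m u^H))); apply: le_trans uu_le _; exact: lerD.
  have e_conj : e^* = e by rewrite conj_Creal// ltr0_real.
  rewrite /u adjmxB adjmxZ e_conj mulmxBl !mulmxBr -!scalemxAl -!scalemxAr.
  rewrite !raddfB /= !mxtraceZ adjmxM hS !mulmxA.
  have wSw : 0 <= \tr (w *m S *m w^H) by exact/psd_tr_ge0/psd_congr.
  have ww := trmul_adj_ge0 w.
  set x := \tr (w *m S *m w^H) in wSw *; set y := \tr (w *m w^H) in ww *.
  rewrite -(subr_le0 (\tr (w *m S *m S *m w^H))).
  set z : C := \tr (w *m S *m S *m w^H) => le_z.
  apply: trmul_adj_eq0; rewrite -/y.
  (* [le_z] says [|w S - e w|^2 <= |w S|^2]. Expanded, it reads [e^2 |w|^2 <= 2 e (w S w^H)], whose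
     right side is at most 0. *)
  have : e * (e * y) <= 0.
    have := le_z; rewrite (_ : _ - z = e * (e * y) - (e * x) *+ 2); last by ring.
    by rewrite subr_le0 => /le_trans; apply; rewrite mulrn_wle0// nmulr_rle0.
  by rewrite nmulr_rle0// nmulr_rge0.
(* Undo the conjugation. [A G] and [G A] are both [1 - q], which fixes [M L^H] from the left because
   it fixes [M], and from the right because [M L^H] is Hermitian. *)
have := psd_congr A pH.
have MpL : M *m L^H *m G *m A = M *m L^H.
  have GA : G *m A = diagf (fun i => 1 - q i).
    by rewrite -hG -hA -adjmxM AG diagf_adj.
  by rewrite -(mulmxA _ G) GA ML -mulmxA -{2}pM adjmxM diagf_adj.
rewrite hA mulmxBr mulmxBl ASA !mulmxA AG -!(mulmxA (diagf _)) !mulmxA.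
by rewrite -!(mulmxA _ M) -(mulmxA _ (M *m L^H)) -(mulmxA _ (_ *m G)) MpL mulmxA pM.
Qed.

End GeometricMean.

(** * Monotonicity of the affinity *)

Section Affinity.
Variable C : numClosedFieldType.

Lemma lin1_mx_ex p q (f : 'rV[C]_p -> 'rV[C]_q) : linear f ->
  exists M, forall u, u *m M = f u.
Proof.
move=> f_lin.
pose F : {linear 'rV[C]_p -> 'rV[C]_q} :=
  HB.pack f (GRing.isLinear.Build C 'rV[C]_p 'rV[C]_q *:%R f f_lin).
by exists (lin1_mx F) => u; rewrite mul_rV_lin1.
Qed.

Lemma trmul_mxvec p q (A B : 'M[C]_(p, q)) :
  \tr (mxvec A *m (mxvec B)^H) = \tr (A *m B^H).
Proof.
rewrite !trmul_adjE big_ord1 pair_bigA /=.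
rewrite (reindex _ (curry_mxvec_bij p q)) /=.
by apply: eq_bigr => -[i j] _; rewrite !mxvecE.
Qed.

Lemma eq_mx_form p (A B : 'M[C]_p) :
  (forall u v : 'rV_p, \tr (u *m A *m v^H) = \tr (u *m B *m v^H)) -> A = B.
Proof.
move=> AB; apply/matrixP => i j.
have mxij (M : 'M[C]_p) : M i j = \tr ((delta_mx 0 i : 'rV_p) *m M *m (delta_mx 0 j)^H).
  rewrite -rowE -mx11_tr mxE (bigD1 j)//= big1 => [|k kj].
    by rewrite adjmxE !mxE !eqxx conjC1 mulr1 addr0.
  by rewrite adjmxE !mxE (negPf kj) conjC0 mulr0.
by rewrite !mxij.
Qed.

Lemma trmul_diagf2 p q (d : 'I_p -> C) (e : 'I_q -> C) (V : 'M_(p, q)) :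
  \tr (diagf d *m V *m diagf e *m V^H)
    = \sum_i \sum_j d i * e j * (V i j * (V i j)^*).
Proof.
rewrite trmul_adjE; apply: eq_bigr => i _; apply: eq_bigr => j _.
by rewrite mul_mx_diag mxE mul_diag_mx !mxE; ring.
Qed.

Lemma big_enum_triple m n (F : 'I_#|{: 'I_m * 'I_n * 'I_n}| -> C) :
  \sum_x F x = \sum_i \sum_j \sum_k F (enum_rank (i, j, k)).
Proof.
rewrite (reindex _ (onW_bij _ (enum_rank_bij _))) /=.
by rewrite pair_bigA pair_bigA /=; apply: eq_bigr => -[[i j] k] _.
Qed.

(** The stacked [K i] form an isometry, so [W |-> (W (K i)^H)] preserves the norm, and its adjoint
    [Y |-> W] is a contraction. *)
Lemma kraus_contract n m l (K : 'I_m -> 'M[C]_n) (Y : 'I_m -> 'M_(l, n)) :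
  \sum_i (K i)^H *m K i = 1%:M ->
  \tr ((\sum_i Y i *m K i) *m (\sum_i Y i *m K i)^H)
    <= \sum_i \tr (Y i *m (Y i)^H).
Proof.
move=> K1; set W := \sum_i Y i *m K i.
have WE : \sum_i \tr (Y i *m (W *m (K i)^H)^H) = \tr (W *m W^H).
  by rewrite -raddf_sum [in RHS]mulmx_suml /=; congr (\tr _); apply: eq_bigr => i _;
    rewrite adjmxM adjmxK mulmxA.
have WW : \sum_i \tr (W *m (K i)^H *m (W *m (K i)^H)^H) = \tr (W *m W^H).
  rewrite -raddf_sum /= -[X in _ = \tr (X *m _)]mulmx1 -K1 mulmx_sumr mulmx_suml.
  by congr (\tr _); apply: eq_bigr => i _; rewrite adjmxM adjmxK !mulmxA.
have WE' : \sum_i \tr (W *m (K i)^H *m (Y i)^H) = \tr (W *m W^H).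
  rewrite -[RHS]geC0_conj ?trmul_adj_ge0// -WE rmorph_sum.
  by apply: eq_bigr => i _; rewrite /= -trmul_adjC.
rewrite -(lerD2r (\tr (W *m W^H))) -{1}WE -{1}WE' -WW -!big_split /=.
by apply: ler_sum => i _; exact: trmul_adj_amgm.
Qed.

(** Apply [kraus_contract] to [Y i = r (K i)^H (X i)]. This bounds the form of left multiplication
    by [r^2], pulled back along the Kraus map, by the forms of the compressed operators. *)
Lemma kadison_schwarz n m (r : 'M[C]_n) (K X : 'I_m -> 'M[C]_n)
    (Z := r *m \sum_i (K i)^H *m X i *m K i) :
  r^H = r -> \sum_i (K i)^H *m K i = 1%:M ->
  \tr (Z *m Z^H) <= \sum_i \tr ((X i)^H *m (K i *m (r *m r) *m (K i)^H) *m X i).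
Proof.
move=> hr K1; have -> : Z = \sum_i (r *m (K i)^H *m X i) *m K i.
  by rewrite /Z mulmx_sumr; apply: eq_bigr => i _; rewrite !mulmxA.
apply: le_trans (kraus_contract _ K1) _; apply: ler_sum => i _.
by rewrite mxtrace_mulC !adjmxM adjmxK hr !mulmxA.
Qed.

(** Left multiplication by [A] is diagonal in the eigenbasis of [A], whatever unitary [Q] acts on
    the other side. [Q] can thus be the eigenbasis of a second matrix, and right multiplication is
    covered by passing to adjoints. *)
Lemma spectral_form n (A U Q : 'M[C]_n) (X := (spectralmx A)^H *m U *m Q) :
  A = A^H -> Q *m Q^H = 1%:M ->
  \tr (X^H *m A *m X)
    = \sum_i \sum_j spectral_diag A 0 i * (U i j * (U i j)^*).
Proof.
move=> hA QQ; set d := spectral_diag A 0; set P := spectralmx A in X *.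
have AE : A = P^H *m diagf d *m P.
  rewrite -[LHS]fcal_id// /fcal spectralmxV; congr (_ *m diag_mx _ *m _).
  by apply/rowP => i; rewrite !mxE.
rewrite {1}AE !adjmxM adjmxK !mulmxA -(mulmxA _ P) spectralmxK mulmx1.
rewrite -(mulmxA _ P) spectralmxK mulmx1 -mulmxA mxtrace_mulC !mulmxA.
rewrite -(mulmxA _ Q) QQ mulmx1 mxtrace_mulC mulmxA -[_ *m U]mulmx1.
have -> : 1%:M = diagf (fun=> 1) :> 'M[C]_n.
  by apply/matrixP => i j; rewrite !mxE.
rewrite trmul_diagf2; apply: eq_bigr => i _; apply: eq_bigr => j _.
by rewrite mulr1.
Qed.

Lemma affinity_ge0 n (rho sigma : 'M[C]_n) :
  psdmx rho -> psdmx sigma -> 0 <= affinity rho sigma.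
Proof.
move=> pr ps; have [ar as_] := (msqrt_psd pr, msqrt_psd ps).
rewrite /affinity -(msqrtK as_) mulmxA mxtrace_mulC mulmxA.
by rewrite -{2}(msqrt_adj as_); exact/psd_tr_ge0/psd_congr.
Qed.

(** The weights are the squared overlaps of the two eigenbases: the affinity is the form of the
    diagonal geometric mean, evaluated at the identity written in these bases. *)
Lemma affinityE n (A B : 'M[C]_n) (V := spectralmx A *m (spectralmx B)^H) :
  affinity A B = \sum_i \sum_j sqrtC (spectral_diag A 0 i) *
     sqrtC (spectral_diag B 0 j) * (V i j * (V i j)^*).
Proof.
rewrite -trmul_diagf2 /affinity /msqrt !spectralmxV /V adjmxM adjmxK.
rewrite -!mulmxA mxtrace_mulC -!mulmxA /diagf.
have E (A' : 'M[C]_n) :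
    map_mx sqrtC (spectral_diag A') = \row_i sqrtC (spectral_diag A' 0 i).
  by apply/rowP => i; rewrite !mxE.
by rewrite !E.
Qed.

Lemma affinity_mono n m (rho sigma : 'M[C]_n) (K : 'I_m -> 'M_n) :
  psdmx rho -> psdmx sigma -> \sum_i (K i)^H *m K i = 1%:M ->
  affinity rho sigma <=
    \sum_i affinity (K i *m rho *m (K i)^H) (K i *m sigma *m (K i)^H).
Proof.
move=> pr ps K1.
pose A i := K i *m rho *m (K i)^H; pose B i := K i *m sigma *m (K i)^H.
have [hr rr] := (msqrt_adj pr, msqrtK pr).
have [hs ss] := (msqrt_adj ps, msqrtK ps).
rewrite {1}/affinity; set r := msqrt rho in hr rr *; set s := msqrt sigma in hs ss *.
clearbody r s.
have pA i : psdmx (A i) by exact: psd_congr.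
have pB i : psdmx (B i) by exact: psd_congr.
pose P i := spectralmx (A i); pose Q i := spectralmx (B i).
(* A vector of length [N] encodes a family of matrices: the triple [(i, j, k)] addresses entry
   [(j, k)] of block [i] in the eigenbases of [A i] and [B i]. There, left multiplication by [A i]
   and right multiplication by [B i] are both diagonal, with entries [a] and [b]. *)
pose N := #|{: 'I_m * 'I_n * 'I_n}|.
pose blk (u : 'rV[C]_N) i : 'M_n := \matrix_(j, k) u 0 (enum_rank (i, j, k)).
pose X u i := (P i)^H *m blk u i *m Q i.
pose T u := \sum_i (K i)^H *m X u i *m K i.
pose f u := mxvec (r *m T u); pose g u := mxvec (T u *m s).
have T_lin : linear T.
  move=> c u v; rewrite /T scaler_sumr -big_split; apply: eq_bigr => i _ /=.
  rewrite scalemxAl scalemxAr -mulmxDl -mulmxDr /X scalemxAl scalemxAr.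
  rewrite -mulmxDl -mulmxDr; congr (_ *m (_ *m _ *m _) *m _).
  by apply/matrixP => j k; rewrite !mxE.
have [M ME] : exists M, forall u, u *m M = f u.
  by apply: lin1_mx_ex => c u v; rewrite /f T_lin mulmxDr -scalemxAr linearP.
have [L LE] : exists M, forall u, u *m M = g u.
  by apply: lin1_mx_ex => c u v; rewrite /g T_lin mulmxDl -scalemxAl linearP.
pose a (x : 'I_N) := spectral_diag (A (enum_val x).1.1) 0 (enum_val x).1.2.
pose b (x : 'I_N) := spectral_diag (B (enum_val x).1.1) 0 (enum_val x).2.
(* [c] holds the coordinates of the family [(1, ..., 1)], which [T] sends to the identity. *)
pose c : 'rV[C]_N := \row_x let: (i, j, k) := enum_val x in (P i *m (Q i)^H) j k.
have blkc i : blk c i = P i *m (Q i)^H.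
  by apply/matrixP => j k; rewrite !mxE enum_rankK mxE.
have Tc : T c = 1%:M.
  rewrite -K1; apply: eq_bigr => i _.
  rewrite /X blkc !mulmxA -(mulmxA _ (P i)^H) !spectralmxVK mulmx1.
  by rewrite -(mulmxA _ (Q i)^H) spectralmxVK mulmx1.
have : psdmx (diagf (fun i => sqrtC (a i) * sqrtC (b i)) - M *m L^H).
  apply: geomean_max => [x|x|u|u|]; try exact: psd_spectral_ge0.
  - rewrite ME /f trmul_mxvec trmul_diagf.
    apply: le_trans (kadison_schwarz _ hr K1) _.
    rewrite big_enum_triple; apply: ler_sum => i _.
    rewrite rr -/(A i) spectral_form; last exact: spectralmxK.
      apply: ler_sum => j _; apply: ler_sum => k _.
      by rewrite /a mxE enum_rankK.
    by case: (pA i).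
  - rewrite LE /g trmul_mxvec trmul_diagf.
    (* Taking adjoints turns right multiplication by [s] into left multiplication, with the roles of
       [P i] and [Q i] exchanged. *)
    have -> : T u *m s = (s *m \sum_i (K i)^H *m (X u i)^H *m K i)^H.
      rewrite adjmxM hs adjmx_sum; congr (_ *m _); apply: eq_bigr => i _.
      by rewrite !adjmxM !adjmxK mulmxA.
    rewrite adjmxK mxtrace_mulC.
    apply: le_trans (kadison_schwarz _ hs K1) _.
    rewrite big_enum_triple; apply: ler_sum => i _.
    have -> : (X u i)^H = (Q i)^H *m (blk u i)^H *m P i.
      by rewrite !adjmxM adjmxK mulmxA.
    rewrite ss -/(B i) spectral_form; last exact: spectralmxK.
      rewrite exchange_big; apply: ler_sum => j _; apply: ler_sum => k _.
      by rewrite /b !adjmxE mxE enum_rankK /= conjCK [_^* * _]mulrC.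
    by case: (pB i).
  (* By cyclicity of the trace, both forms are [tr (r (T u) s (T v)^H)]. *)
  - apply: eq_mx_form => u v; rewrite !mulmxA -![u *m _ *m _ *m _]mulmxA.
    rewrite -!adjmxM ME !LE ME.
    rewrite !trmul_mxvec !adjmxM hr hs !mulmxA.
    by rewrite -!mulmxA mxtrace_mulC !mulmxA.
(* At [c] the form of [M L^H] is [tr (r s)], the affinity of [rho] and [sigma], and the diagonal
   form is the sum of the affinities of the [A i] and [B i]. *)
case=> _ /(_ c).
rewrite mx11_tr mulmxBr mulmxBl raddfB /= subr_ge0.
rewrite mulmxA -mulmxA -adjmxM ME LE /f /g Tc mulmx1 mul1mx trmul_mxvec hs.
move=> /le_trans; apply.
rewrite trmul_diagf big_enum_triple; apply: ler_sum => i _.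
rewrite affinityE; apply: ler_sum => j _; apply: ler_sum => k _.
by rewrite [c _ _]mxE /a /b enum_rankK.
Qed.
End Affinity.

(** * Homogeneity, Cauchy-Schwarz, and the final assembly *)

Lemma sedrakyan (C : numClosedFieldType) m (x q : 'I_m -> C) :
  (forall i, x i \is Num.real) -> (forall i, 0 < q i) -> \sum_i q i = 1 ->
  (\sum_i x i) ^+ 2 <= \sum_i x i ^+ 2 / q i.
Proof.
move=> x_real q_gt0 q1; set s := \sum_i x i.
have s_real : s \is Num.real by exact: rpred_sum.
(* This is the variance of [x i / q i] under the probability weights [q i], whose mean is [s]. *)
have : 0 <= \sum_i q i * (x i / q i - s) ^+ 2.
  apply: sumr_ge0 => i _; apply: mulr_ge0; first exact: ltW.
  by rewrite real_exprn_even_ge0// rpredB// rpredM// rpredV gtr0_real.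
rewrite (eq_bigr (fun i => x i ^+ 2 / q i - (s * x i) *+ 2 + s ^+ 2 * q i)); last first.
  by move=> i _; field; rewrite gt_eqF.
rewrite big_split sumrB /= -mulr_sumr q1 mulr1 sumrMnl -mulr_sumr -/s.
by rewrite -expr2 mulr2n opprD addrA subrK subr_ge0.
Qed.

Lemma affinityZ (C : numClosedFieldType) n (A B : 'M[C]_n) a b :
  0 <= a -> 0 <= b -> psdmx A -> psdmx B ->
  affinity (a *: A) (b *: B) = sqrtC a * sqrtC b * affinity A B.
Proof.
move=> a0 b0 pA pB; rewrite /affinity !msqrtZ//.
by rewrite -scalemxAl -scalemxAr !mxtraceZ mulrA.
Qed.

Lemma fidelityZ (C : numClosedFieldType) n (A B : 'M[C]_n) a b :
  0 <= a -> 0 <= b -> psdmx A -> psdmx B ->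
  fidelity (a *: A) (b *: B) = sqrtC a * sqrtC b * fidelity A B.
Proof.
move=> a0 b0 pA pB; rewrite /fidelity (msqrtZ b0 pB).
rewrite -!scalemxAl -!scalemxAr -!scalemxAl !scalerA.
rewrite mulrA -expr2 sqrtCK msqrtZ ?mulr_ge0//; last first.
  by rewrite -{2}(msqrt_adj pB); exact: psd_congr.
by rewrite mxtraceZ rootCMl// (mulrC (sqrtC b)).
Qed.

(** Fidelity and affinity enter only through nonnegativity, homogeneity of degree 1/2 in each
    argument, and the summed inequality for the Kraus family, so one argument serves both. *)
Lemma strong_contract (C : numClosedFieldType) n m (X : 'M[C]_n -> 'M[C]_n -> C)
    (rho sigma : 'M[C]_n) (K : 'I_m -> 'M[C]_n) :
  (forall A B, psdmx A -> psdmx B -> 0 <= X A B) ->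
  (forall A B a b, 0 <= a -> 0 <= b -> psdmx A -> psdmx B ->
     X (a *: A) (b *: B) = sqrtC a * sqrtC b * X A B) ->
  X rho sigma <= \sum_i X (K i *m rho *m (K i)^H) (K i *m sigma *m (K i)^H) ->
  density rho -> density sigma ->
  \sum_i (K i)^H *m K i = 1%:M ->
  (forall i, 0 < \tr (K i *m rho *m (K i)^H)) ->
  (forall i, 0 < \tr (K i *m sigma *m (K i)^H)) ->
  \sum_(i < m) \tr (K i *m rho *m (K i)^H) *
      dX X ((\tr (K i *m rho *m (K i)^H))^-1 *: (K i *m rho *m (K i)^H))
           ((\tr (K i *m sigma *m (K i)^H))^-1 *: (K i *m sigma *m (K i)^H))
    <= dX X rho sigma.
Proof.
move=> X_ge0 XZ X_mono [pr tr_] [ps ts] K1 p_gt0 q_gt0.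
have tr1 tau : \sum_i \tr (K i *m tau *m (K i)^H) = \tr tau.
  rewrite -[in RHS](mulmx1 tau) -K1 mulmx_sumr raddf_sum /=.
  by apply: eq_bigr => i _; rewrite mxtrace_mulC !mulmxA mxtrace_mulC mulmxA.
pose x i := X (K i *m rho *m (K i)^H) (K i *m sigma *m (K i)^H).
have x_ge0 i : 0 <= x i by apply: X_ge0; exact: psd_congr.
have q1 : \sum_i \tr (K i *m sigma *m (K i)^H) = 1 by rewrite tr1.
pose q i := \tr (K i *m sigma *m (K i)^H).
(* By homogeneity the squared term carries [1 / (p_i q_i)]; the outer weight [p_i] cancels, and the
   [q_i] remain as the weights for [sedrakyan]. *)
rewrite (eq_bigr (fun i => \tr (K i *m rho *m (K i)^H) - x i ^+ 2 / q i)); last first.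
  move=> i _; rewrite /dX XZ ?invr_ge0 ?ltW//; try exact: psd_congr.
  rewrite !exprMn !sqrtCK -/(x i) -/(q i).
  by field; rewrite (gt_eqF (p_gt0 i)) (gt_eqF (q_gt0 i)).
rewrite sumrB tr1 tr_ /dX lerD2l lerN2.
apply: le_trans (sedrakyan (fun i => ger0_real (x_ge0 i)) q_gt0 q1).
by rewrite lerXn2r// nnegrE ?X_ge0// sumr_ge0.
Qed.

Theorem theorem1 (C : numClosedFieldType) (n m : nat)
    (X : 'M[C]_n -> 'M[C]_n -> C)
    (hX : X = @fidelity C n \/ X = @affinity C n)
    (rho sigma : 'M[C]_n) (K : 'I_m -> 'M[C]_n) :
  density rho -> density sigma ->
  \sum_(i < m) adjmx (K i) *m K i = 1%:M ->
  (forall i, 0 < \tr (K i *m rho *m adjmx (K i))) ->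
  (forall i, 0 < \tr (K i *m sigma *m adjmx (K i))) ->
  \sum_(i < m) \tr (K i *m rho *m adjmx (K i)) *
      dX X ((\tr (K i *m rho *m adjmx (K i)))^-1 *: (K i *m rho *m adjmx (K i)))
           ((\tr (K i *m sigma *m adjmx (K i)))^-1 *: (K i *m sigma *m adjmx (K i)))
    <= dX X rho sigma.
Proof.
move=> dr ds K1; have [[pr _] [ps _]] := (dr, ds).
case: hX => ->; apply: strong_contract => //.
- by move=> A B; exact: fidelity_ge0.
- by move=> A B a b; exact: fidelityZ.
- exact: fidelity_mono.
- by move=> A B; exact: affinity_ge0.
- by move=> A B a b; exact: affinityZ.
exact: affinity_mono.
Qed.
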